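(* There exist arbitrarily long steady words over a $4$-letter alphabet; that is, for every $n\ge 1$ there is a steady word of length at least $n$ over the alphabet $\{\mathtt{1},\mathtt{2},\mathtt{3},\mathtt{4}\}$.
   Context: A word is a finite sequence of letters from an alphabet. A factor of a word $W$ is a contiguous subword, i.e. $W=PUS$ with $P,S$ possibly empty. A square is a nonempty word of the form $XX$. A word is square-free if it has no factor that is a square. A square-free word $W$ is steady if every word obtained from $W$ by deleting exactly one letter (at any position, including the first and last) is square-free. *)

(* Defs.v *)
From mathcomp Require Import all_boot.
Set Implicit Arguments. Unset Strict Implicit. Unset Printing Implicit Defensive.

Definition factor {T : Type} (u w : seq T) : Prop :=
  exists p s : seq T, w = p ++ u ++ s.

Definition square {T : Type} (u : seq T) : Prop :=
  exists x : seq T, x <> [::] /\ u = x ++ x.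

Definition square_free {T : Type} (w : seq T) : Prop :=
  forall u, factor u w -> ~ square u.

Definition delete_at {T : Type} (i : nat) (w : seq T) : seq T :=
  take i w ++ drop i.+1 w.

Definition steady {T : Type} (w : seq T) : Prop :=
  square_free w /\ forall i, i < size w -> square_free (delete_at i w).

(* Main.v *)
(** Steadiness is the absence of squares and of near-squares: factors UV in
    which one of U, V arises from the other by deleting a letter, i.e.
    P c Q P Q or P Q P c Q with m = |PQ| > 0.  In terms of positions, these are
    two intervals of total length m, repeated at distances m and m + 1.

    An explicit 44-uniform morphism (found by computer search) maps steady words
    over {0,1,2,3} to steady words, so that its iterates are as required.  Two
    finite checks make it recognizable: equal factors of length 15 of an image
    start at the same offset modulo 44, and distinct blocks never agree on 14
    aligned letters.  In a near-square of an image, let p + q = m be the lengths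
    of P and Q.  If both are at least 15, then 44 divides both m and m + 1.  If
    only one is, the corresponding distance is a multiple 44 d, and the long
    interval is so long that the preimage contains a square of period d.  If
    both are at most 14, the near-square lies in the image of three consecutive
    letters, and these images are checked by computation. *)

Require Import Defs.
From mathcomp Require Import all_boot.
From mathcomp Require Import zify.

Set Implicit Arguments.
Unset Strict Implicit.
Unset Printing Implicit Defensive.

(** * Reflection of steadiness along maps of letters *)

Lemma factor_map (S T : Type) (g : S -> T) (u w : seq S) :
  factor u w -> factor (map g u) (map g w).
Proof. by move=> [p [s ->]]; exists (map g p), (map g s); rewrite !map_cat. Qed.

Lemma square_map (S T : Type) (g : S -> T) (u : seq S) :
  square u -> square (map g u).
Proof.
move=> [x [x0 ->]]; exists (map g x); rewrite map_cat; split=> //.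
by case: x x0.
Qed.

Lemma square_free_map (S T : Type) (g : S -> T) (w : seq S) :
  square_free (map g w) -> square_free w.
Proof.
by move=> sf u /(factor_map g) uw /(square_map g); apply: sf uw.
Qed.

Lemma steady_map (S T : Type) (g : S -> T) (w : seq S) :
  steady (map g w) -> steady w.
Proof.
move=> [sf del]; split=> [|i iw]; first exact: square_free_map sf.
apply: (square_free_map (g := g)).
by rewrite /delete_at map_cat map_take map_drop; apply: del; rewrite size_map.
Qed.

(** * Near-squares and steadiness *)

Definition repeats (w : seq nat) (d i l : nat) : Prop :=
  forall x, i <= x < i + l -> nth 0 w x = nth 0 w (x + d).

(* In [near_square_left] the extra letter is the one at position [i + p], in
   [near_square_right] the one at position [i + m + p]. *)
Variant near_square_at (w : seq nat) (i m p : nat) : Prop :=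
| near_square_exact of i + m.*2 <= size w & repeats w m i m
| near_square_left of i + m.*2 < size w &
    repeats w m.+1 i p & repeats w m (i + p).+1 (m - p)
| near_square_right of i + m.*2 < size w &
    repeats w m i p & repeats w m.+1 (i + p) (m - p).

Definition near_square_free (w : seq nat) : Prop :=
  forall i m p, 0 < m -> p <= m -> ~ near_square_at w i m p.

Lemma square_free_repeats (w : seq nat) :
  (forall i m, 0 < m -> i + m.*2 <= size w -> ~ repeats w m i m) ->
  square_free w.
Proof.
move=> + u [p [s wE]] [x [x0 uE]]; rewrite {w}wE => nrep.
have xgt0 : 0 < size x by case: x x0 {uE}.
apply: (nrep (size p) (size x)) => //; first by rewrite uE !size_cat; lia.
have nth_u z : z < size x + size x ->
    nth 0 (p ++ u ++ s) (size p + z) = nth 0 (x ++ x) z.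
  move=> zx; rewrite uE nth_cat ltnNge leq_addr /= addKn nth_cat size_cat.
  by rewrite zx.
move=> y yi; have -> : y = size p + (y - size p) by lia.
rewrite -addnA !nth_u ?nth_cat; [|lia..].
by rewrite ifT ?ifF ?addnK //; lia.
Qed.

Lemma nth_delete_at (w : seq nat) i j : i < size w ->
  nth 0 (delete_at i w) j = nth 0 w (if j < i then j else j.+1).
Proof.
move=> iw; rewrite /delete_at nth_cat size_take iw.
case: ifP => ji; first by rewrite nth_take.
by rewrite nth_drop; congr nth; lia.
Qed.

Lemma size_delete_at (w : seq nat) i : i < size w ->
  size (delete_at i w) = (size w).-1.
Proof. by move=> iw; rewrite /delete_at size_cat size_take size_drop iw; lia. Qed.

Lemma near_square_free_steady (w : seq nat) : near_square_free w -> steady w.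
Proof.
move=> nsf; split=> [|i iw]; apply: square_free_repeats.
  by move=> i m m0 im rep; apply: (nsf i m 0 m0 isT); apply: near_square_exact.
move=> a m m0; rewrite size_delete_at // => am rep.
have {}rep x : a <= x < a + m ->
    nth 0 w (if x < i then x else x.+1) =
    nth 0 w (if x + m < i then x + m else (x + m).+1).
  by move=> xa; rewrite -!nth_delete_at //; apply: rep.
(* The deleted letter lies before the square, in or just after its first half, inside its second
   half, or after it. In the two middle cases it is the extra letter of a near-square of [w]. *)
have [ia|ai] := ltnP i a.
  apply: (nsf a.+1 m 0) => //; apply: near_square_exact; first lia.
  move=> x xi; have := rep x.-1; rewrite !ifF; [|lia..].
  have -> : x.-1.+1 = x by lia.
  have -> : (x.-1 + m).+1 = x + m by lia.
  by apply; lia.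
have [iam|ami] := leqP i (a + m).
  apply: (nsf a m (i - a)) => //; first lia.
  apply: near_square_left; first lia; move=> x xi.
    have := rep x; rewrite ifT; last lia.
    by rewrite ifF; [rewrite addnS; apply|]; lia.
  have := rep x.-1; rewrite !ifF; [|lia..].
  have -> : x.-1.+1 = x by lia.
  have -> : (x.-1 + m).+1 = x + m by lia.
  by apply; lia.
have [ia2|ai2] := ltnP i (a + m.*2).
  apply: (nsf a m (i - a - m)) => //; first lia.
  apply: near_square_right; first lia; move=> x xi; have := rep x.
    by rewrite !ifT; [apply|..]; lia.
  rewrite ifT; last lia.
  by rewrite ifF; [rewrite addnS; apply|]; lia.
apply: (nsf a m 0) => //; apply: near_square_exact; first lia.
by move=> x xi; have := rep x; rewrite !ifT; [apply|..]; lia.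
Qed.

(** * Computable tests for near-squares *)

(** Written with [if] rather than [&&], so that the call-by-value [vm_compute] stops at the first
    mismatch. *)
Fixpoint agree (l : nat) (s t : seq nat) : bool :=
  match l, s, t with
  | 0, _, _ => true
  | l'.+1, x :: s', y :: t' => if x == y then agree l' s' t' else false
  | _, _, _ => false
  end.

Lemma agreeT l s t : l <= size s -> l <= size t ->
  (forall j, j < l -> nth 0 s j = nth 0 t j) -> agree l s t.
Proof.
elim: l s t => [|l IH] [|x s] [|y t] //= ls lt e.
have /= -> := e 0 isT; rewrite eqxx; apply: IH => // j jl.
exact: (e j.+1).
Qed.

(* [take l t] arises from [take l.+1 s] by deleting one letter *)
Fixpoint agree_deleted (l : nat) (s t : seq nat) : bool :=
  match l, s, t with
  | 0, _, _ => true
  | l'.+1, x :: s', y :: t' =>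
      if agree l s' t then true
      else if x == y then agree_deleted l' s' t' else false
  | _, _, _ => false
  end.

Lemma agree_deletedT l p s t : p <= l -> l < size s -> l <= size t ->
  (forall j, j < p -> nth 0 s j = nth 0 t j) ->
  (forall j, p <= j < l -> nth 0 s j.+1 = nth 0 t j) ->
  agree_deleted l s t.
Proof.
elim: l p s t => [|l IH] p [|x s] [|y t] // pl ls lt e1 e2.
change (if agree l.+1 s (y :: t) then true
  else if x == y then agree_deleted l s t else false).
case: p pl e1 e2 => [|p] pl e1 e2; first by rewrite agreeT.
case: ifP => // _; have /= -> := e1 0 isT; rewrite eqxx.
apply: (IH p) => // j jl; first exact: (e1 j.+1).
exact: (e2 j.+1).
Qed.

Definition near_square_prefix (m : nat) (s : seq nat) : bool :=
  [|| agree m s (drop m s), agree_deleted m s (drop m.+1 s)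
    | agree_deleted m (drop m s) s].

Definition near_square_free_upto (N : nat) (s : seq nat) : bool :=
  all (fun i => all (fun m => ~~ near_square_prefix m (drop i s)) (iota 1 N))
      (iota 0 (size s)).

Lemma near_square_free_uptoP N s : near_square_free_upto N s ->
  forall i m p, 0 < m <= N -> p <= m -> ~ near_square_at s i m p.
Proof.
move=> chk i m p mN pm ns.
have is_ : i < size s by case: ns; lia.
have : ~~ near_square_prefix m (drop i s).
  by apply: (allP (allP chk i _)); rewrite mem_iota; lia.
rewrite /near_square_prefix drop_drop !negb_or => /and3P[/negP n1 /negP n2 /negP n3].
case: ns => [im rep|im repP repQ|im repP repQ].
- apply: n1; apply: agreeT; rewrite ?size_drop; [lia..|] => j jm.
  rewrite !nth_drop rep; last lia.
  by congr nth; lia.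
- apply: n2; rewrite drop_drop.
  apply: (agree_deletedT pm); rewrite ?size_drop; [lia..| |] => j jm.
    rewrite !nth_drop repP; last lia.
    by congr nth; lia.
  rewrite !nth_drop repQ; last lia.
  by congr nth; lia.
- apply: n3; apply: (agree_deletedT pm); rewrite ?size_drop; [lia..| |] => j jm.
    rewrite !nth_drop.
    have -> : m + i + j = i + j + m by lia.
    by rewrite -repP //; lia.
  rewrite !nth_drop.
  have -> : m + i + j.+1 = i + j + m.+1 by lia.
  by rewrite -repQ //; lia.
Qed.

(** * The morphism and its finite checks *)

Definition block (a : nat) : seq nat :=
  match a with
  | 0 => [:: 2; 3; 1; 0; 3; 2; 1; 3; 0; 2; 3; 1; 2; 0; 1; 3; 2; 1; 0; 2; 3; 0;
             1; 2; 0; 3; 1; 0; 2; 3; 0; 1; 3; 2; 1; 0; 2; 3; 1; 2; 0; 1; 3; 0]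
  | 1 => [:: 2; 3; 1; 0; 3; 2; 0; 1; 2; 3; 0; 2; 1; 0; 3; 1; 2; 3; 0; 1; 3; 2;
             0; 3; 1; 0; 2; 3; 0; 1; 2; 0; 3; 2; 1; 0; 2; 3; 1; 2; 0; 1; 3; 0]
  | 2 => [:: 2; 3; 1; 0; 3; 2; 0; 1; 2; 3; 0; 2; 1; 3; 2; 0; 1; 2; 3; 1; 0; 3;
             2; 0; 1; 3; 0; 2; 3; 1; 2; 0; 1; 3; 2; 1; 0; 3; 1; 2; 0; 1; 3; 0]
  | _ => [:: 2; 3; 1; 0; 3; 2; 0; 1; 2; 3; 1; 0; 2; 1; 3; 0; 1; 2; 0; 3; 1; 0;
             2; 3; 0; 1; 3; 2; 0; 3; 1; 2; 3; 0; 2; 1; 0; 3; 1; 2; 0; 1; 3; 0]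
  end.

Definition image (w : seq nat) : seq nat := flatten (map block w).

Lemma size_block a : size (block a) = 44.
Proof. by move: a => [|[|[|a]]]. Qed.

Lemma size_image w : size (image w) = 44 * size w.
Proof.
by elim: w => [|a w IH] //; rewrite /image /= size_cat size_block IH; lia.
Qed.

Lemma image_cat u v : image (u ++ v) = image u ++ image v.
Proof. by rewrite /image map_cat flatten_cat. Qed.

Lemma nth_image_drop w y r : y <= size w ->
  nth 0 (image w) (44 * y + r) = nth 0 (image (drop y w)) r.
Proof.
move=> yw; rewrite -[in LHS](cat_take_drop y w) image_cat nth_cat size_image.
by rewrite size_takel // ifF; [congr nth|]; lia.
Qed.

Lemma nth_image_take w y n r : y + n <= size w -> r < 44 * n ->
  nth 0 (image w) (44 * y + r) = nth 0 (image (take n (drop y w))) r.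
Proof.
move=> yn rn; rewrite nth_image_drop; last lia.
rewrite -[in LHS](cat_take_drop n (drop y w)) image_cat nth_cat size_image.
by rewrite size_takel ?size_drop ?ifT //; lia.
Qed.

Definition letters := iota 0 4.

(** A window of 15 letters meets at most two blocks, and 74 = 88 - 15 + 1 is the number of its
    positions in the image of two letters. The start modulo 44 is stored beside each window. *)
Definition pair_windows : seq (nat * seq nat) :=
  flatten [seq let s := image ab in [seq (r %% 44, drop r s) | r <- iota 0 74]
          | ab <- [seq [:: a; b] | a <- letters, b <- letters] & uniq ab].

Lemma pair_windows_check :
  all (fun u => all (fun v => (u.1 == v.1) || ~~ agree 15 u.2 v.2) pair_windows)
      pair_windows.
Proof. by vm_compute. Qed.

(** The bound 28 = 14 + 14 covers the near-squares with both parts at most 14. *)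
Lemma triple_images_check :
  all (fun abc => near_square_free_upto 28 (image abc))
    [seq abc <- [seq a :: bc | a <- letters,
       bc <- [seq [:: b; c] | b <- letters, c <- letters]] | uniq abc].
Proof. by vm_compute. Qed.

Lemma block_windows_check :
  all (fun ab => all (fun r =>
      ~~ agree 14 (drop r (block ab.1)) (drop r (block ab.2))) (iota 0 31))
    [seq ab <- [seq (a, b) | a <- letters, b <- letters] | ab.1 != ab.2].
Proof. by vm_compute. Qed.

(** * The morphism preserves near-square-freeness *)

Section Image.

Variable w : seq nat.
Hypotheses (w_nsf : near_square_free w) (w_letters : {subset w <= letters}).
Hypothesis w_size : 3 <= size w.

Lemma letters_nth y : y < size w -> nth 0 w y \in letters.
Proof. by move=> yw; apply/w_letters/mem_nth. Qed.

Lemma nth_neq1 y : y.+1 < size w -> nth 0 w y != nth 0 w y.+1.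
Proof.
move=> yw; apply/eqP => e; apply: (w_nsf (i := y) (m := 1) (p := 0)) => //.
apply: near_square_exact => [|x xy]; first lia.
by have -> : x = y; [lia|rewrite e addn1].
Qed.

(** A factor [aba] is a near-square with [P = a] and [Q] empty. *)
Lemma nth_neq2 y : y.+2 < size w -> nth 0 w y != nth 0 w y.+2.
Proof.
move=> yw; apply/eqP => e; apply: (w_nsf (i := y) (m := 1) (p := 1)) => //.
apply: near_square_left => [|x xy|x xy]; [lia| |lia].
by have -> : x = y; [lia|rewrite e addn2].
Qed.

Lemma take2_drop y : y.+1 < size w ->
  take 2 (drop y w) = [:: nth 0 w y; nth 0 w y.+1].
Proof.
move=> yw; rewrite (drop_nth 0 (ltnW yw)) (drop_nth 0 yw).
by rewrite [LHS]/= take0.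
Qed.

Lemma take3_drop y : y.+2 < size w ->
  take 3 (drop y w) = [:: nth 0 w y; nth 0 w y.+1; nth 0 w y.+2].
Proof.
move=> yw; rewrite (drop_nth 0 (ltnW (ltnW yw))) (drop_nth 0 (ltnW yw)).
by rewrite (drop_nth 0 yw) [LHS]/= take0.
Qed.

Lemma triple_image_near_square_free y : y + 3 <= size w ->
  near_square_free_upto 28 (image (take 3 (drop y w))).
Proof.
move=> yw; rewrite take3_drop; last lia.
apply: (allP triple_images_check); rewrite mem_filter; apply/andP; split.
  by rewrite /= !inE negb_or !nth_neq1 ?nth_neq2 //; lia.
apply: (allpairs_f cons); first by apply: letters_nth; lia.
by apply: allpairs_f; apply: letters_nth; lia.
Qed.

Lemma image_no_short_near_square i m p :
  0 < m <= 28 -> p <= m -> ~ near_square_at (image w) i m p.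
Proof.
(* The near-square has at most 57 letters and starts at offset at most 43 in its block, so three
   blocks of 132 letters contain it. The minimum shifts this triple back at the end of [w]. *)
move=> mN pm ns; pose y := minn (i %/ 44) (size w - 3); pose r := i - 44 * y.
have yw : y + 3 <= size w by lia.
have iE : i = 44 * y + r by lia.
have iw : i + m.*2 <= 44 * size w by rewrite -size_image; case: ns; lia.
have sz : size (image (take 3 (drop y w))) = 132.
  by rewrite size_image size_takel // size_drop; lia.
have nthE x : x < 132 ->
    nth 0 (image (take 3 (drop y w))) x = nth 0 (image w) (44 * y + x).
  by move=> xl; rewrite (nth_image_take (n := 3)).
have rep d j l : l > 0 -> j >= i -> j + l + d <= i + m.*2.+1 -> d > 0 ->
    j + l + d <= 44 * size w -> repeats (image w) d j l ->
    repeats (image (take 3 (drop y w))) d (j - 44 * y) l.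
  move=> l0 ji jld d0 jw H x xj; rewrite !nthE; [|lia..].
  by rewrite H; [congr nth|]; lia.
have rep0 d j : repeats (image (take 3 (drop y w))) d j 0 by move=> x; lia.
apply: (near_square_free_uptoP (triple_image_near_square_free yw) mN pm (i := r)).
case: ns; rewrite size_image => im.
- move=> H; apply: near_square_exact; first by rewrite sz; lia.
  by apply: (rep m i) => //; lia.
- move=> H1 H2; apply: near_square_left; first by rewrite sz; lia.
    case: (posnP p) => [->//|p0].
    by apply: (rep m.+1 i) => //; lia.
  case: (posnP (m - p)) => [->//|p0].
  have -> : (r + p).+1 = (i + p).+1 - 44 * y by lia.
  by apply: rep => //; lia.
- move=> H1 H2; apply: near_square_right; first by rewrite sz; lia.
    case: (posnP p) => [->//|p0].
    by apply: (rep m i) => //; lia.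
  case: (posnP (m - p)) => [->//|p0].
  have -> : r + p = i + p - 44 * y by lia.
  by apply: rep => //; lia.
Qed.

Lemma window_image i : i + 15 <= 44 * size w ->
  exists2 u, u \in pair_windows &
    [/\ u.1 = i %% 44, 15 <= size u.2 &
        forall j, j < 15 -> nth 0 u.2 j = nth 0 (image w) (i + j)].
Proof.
move=> iw; pose y := minn (i %/ 44) (size w - 2); pose r := i - 44 * y.
have yw : y + 2 <= size w by lia.
have iE : i = 44 * y + r by lia.
have r74 : r < 74 by lia.
exists (r %% 44, drop r (image (take 2 (drop y w)))); last first.
  split=> /=; first lia.
    by rewrite size_drop size_image size_takel ?size_drop; lia.
  move=> j j15; rewrite nth_drop -nth_image_take //; last lia.
  by rewrite addnA -iE.
apply/flatten_mapP; exists (take 2 (drop y w)).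
  rewrite take2_drop; last lia.
  rewrite mem_filter; apply/andP; split.
    by rewrite /= inE nth_neq1 //; lia.
  by apply: allpairs_f; apply: letters_nth; lia.
by apply/mapP; exists r => //; rewrite mem_iota.
Qed.

Lemma repeats_image_dvdn d i l : 15 <= l -> i + l + d <= 44 * size w ->
  repeats (image w) d i l -> 44 %| d.
Proof.
move=> l15 ilw rep.
have [|u uP [u1 su eu]] := @window_image i; first lia.
have [|v vP [v1 sv ev]] := @window_image (i + d); first lia.
have := allP (allP pair_windows_check u uP) v vP.
rewrite agreeT // ?orbF => [|j jl]; first by rewrite u1 v1 => /eqP; lia.
by rewrite eu // ev // rep; [congr nth|]; lia.
Qed.

Lemma block_inj a b r : a \in letters -> b \in letters -> r <= 30 ->
  (forall j, j < 14 -> nth 0 (block a) (r + j) = nth 0 (block b) (r + j)) ->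
  a = b.
Proof.
move=> aL bL r30 e; apply/eqP/negPn/negP => ab.
have abP : (a, b) \in [seq ab <- [seq (a, b) | a <- letters, b <- letters]
                      | ab.1 != ab.2].
  by rewrite mem_filter ab; apply: allpairs_f.
have rP : r \in iota 0 31 by rewrite mem_iota; lia.
have /negP := allP (allP block_windows_check _ abP) r rP; apply.
apply: agreeT; rewrite ?size_drop ?size_block; [lia..|] => j j14.
by rewrite !nth_drop e.
Qed.

Lemma nth_image y r : y < size w -> r < 44 ->
  nth 0 (image w) (44 * y + r) = nth 0 (block (nth 0 w y)) r.
Proof.
move=> yw r44; rewrite nth_image_drop; last lia.
by rewrite (drop_nth 0) //= /image /= nth_cat size_block r44.
Qed.

(* At least [d] consecutive blocks meet the interval in 14 or more letters. *)
Lemma image_no_long_repeats d i l : 0 < d -> 44 * d <= l + 15 ->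
  i + l + 44 * d <= 44 * size w -> ~ repeats (image w) (44 * d) i l.
Proof.
(* [y0] is the first block with at least 14 letters at or after position [i], since
   [44 * y0 + 44 - i >= 14] amounts to [y0 >= (i - 30) / 44]. *)
move=> d0 dl ilw rep; pose y0 := (i + 13) %/ 44.
apply: (w_nsf (i := y0) (m := d) (p := 0)) => //.
apply: near_square_exact => [|y yy0]; first lia.
(* The offset in block [y] at which the interval starts or continues; the choice of [y0] makes it at
   most 30. *)
pose r := maxn i (44 * y) - 44 * y.
apply: (@block_inj _ _ r) => [|||j j14].
- by apply: letters_nth; lia.
- by apply: letters_nth; lia.
- lia.
rewrite -!nth_image; [|lia..].
by rewrite rep; [congr nth|]; lia.
Qed.

Lemma near_square_free_image : near_square_free (image w).
Proof.
(* The slack 15 is attained at distance [m.+1] when the other part has 14 letters. *)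
have long_repeats d i l : 0 < d -> 15 <= l -> d <= l + 15 ->
    i + l + d <= 44 * size w -> ~ repeats (image w) d i l.
  move=> d0 l15 dl ilw rep; have /dvdnP[e dE] := repeats_image_dvdn l15 ilw rep.
  rewrite mulnC in dE; rewrite dE in rep; move: rep.
  by apply: image_no_long_repeats; lia.
move=> i m p m0 pm ns.
(* Beyond 28, [p] and [m - p] cannot both be at most 14. *)
have [m28|m28] := leqP m 28.
  by apply: (@image_no_short_near_square i m p) => //; lia.
case: ns; rewrite size_image => im.
- by apply: long_repeats; lia.
- move=> H1 H2; have [p15|p15] := ltnP p 15; first by apply: long_repeats H2; lia.
  have [q15|q15] := ltnP (m - p) 15; first by apply: long_repeats H1; lia.
  have := repeats_image_dvdn p15 _ H1; have := repeats_image_dvdn q15 _ H2; lia.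
- move=> H1 H2; have [p15|p15] := ltnP p 15; first by apply: long_repeats H2; lia.
  have [q15|q15] := ltnP (m - p) 15; first by apply: long_repeats H1; lia.
  have := repeats_image_dvdn p15 _ H1; have := repeats_image_dvdn q15 _ H2; lia.
Qed.

End Image.

(** * Iteration from a three-letter word *)

Lemma image_letters w : {subset image w <= letters}.
Proof.
have blockL a : {subset block a <= letters}.
  by apply/allP; move: a => [|[|[|a]]].
by move=> x /flatten_mapP[a _ /blockL].
Qed.

Lemma near_square_free_012 : near_square_free [:: 0; 1; 2].
Proof.
move=> i m p m0 pm ns.
have m1 : 0 < m <= 1 by case: ns => /=; lia.
have chk : near_square_free_upto 1 [:: 0; 1; 2] by [].
exact: near_square_free_uptoP chk _ _ _ m1 pm ns.
Qed.

Lemma near_square_free_long n : exists w,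
  [/\ n + 3 <= size w, near_square_free w & {subset w <= letters}].
Proof.
elim: n => [|n [w [sw nsf wL]]].
  exists [:: 0; 1; 2]; split=> //; first exact: near_square_free_012.
  exact/allP.
exists (image w); split; first by rewrite size_image; lia.
  by apply: near_square_free_image => //; lia.
exact: image_letters.
Qed.

(* alphabet {1,2,3,4} represented by 'I_4 *)
Theorem mainTheorem1 :
  forall n : nat, 1 <= n -> exists w : seq 'I_4, n <= size w /\ steady w.
Proof.
move=> n _; have [w [sw nsf wL]] := near_square_free_long n.
exists (map (inord : nat -> 'I_4) w); rewrite size_map; split; first lia.
(* Steadiness is pulled back to words over [nat], where [nat_of_ord] undoes [inord] because all
   letters are below 4. *)
apply: (steady_map (g := @nat_of_ord 4)); rewrite -map_comp map_id_in.
  exact: near_square_free_steady.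
by move=> x /wL; rewrite mem_iota => xL; rewrite /= inordK.
Qed.
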